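(* Let $(D,\dashv,\vdash,\theta_\dashv,\theta_\vdash)$ be a diassociative bialgebra and $(B,\diamond,\varpi)$ a quadratic Zinbiel algebra. Then the following two constructions produce the same Lie bialgebra $(D\otimes B,[-,-],\delta)$ (i.e. the square formed by the four constructions commutes): (I) First form the ASI bialgebra $(D\otimes B,\cdot,\Delta)$ with $(d_1\otimes b_1)\cdot(d_2\otimes b_2)=(d_1\vdash d_2)\otimes(b_1\diamond b_2)+(d_1\dashv d_2)\otimes(b_2\diamond b_1)$ and $\Delta(d\otimes b)=\theta_\vdash(d)\bullet\nu_\varpi(b)+\theta_\dashv(d)\bullet\tau(\nu_\varpi(b))$, and then its induced Lie bialgebra, with bracket $[a_1,a_2]=a_1\cdot a_2-a_2\cdot a_1$ and cobracket $\delta=\Delta-\tau\Delta$. (II) First form the Leibniz bialgebra $(D,\ast,\vartheta)$ with $d_1\ast d_2=d_1\vdash d_2-d_2\dashv d_1$ and $\vartheta=\theta_\vdash-\tau\theta_\dashv$, and then the Lie bialgebra on $D\otimes B$ with bracket $[d_1\otimes b_1,d_2\otimes b_2]=(d_1\ast d_2)\otimes(b_1\diamond b_2)-(d_2\ast d_1)\otimes(b_2\diamond b_1)$ and cobracket $\delta(d\otimes b)=(\mathrm{id}\otimes\mathrm{id}-\tau)\big(\vartheta(d)\bullet\nu_\varpi(b)\big)$.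
   Context: All vector spaces are finite-dimensional over a field $\Bbbk$ of characteristic zero; $\tau(x\otimes y)=y\otimes x$; $(d'\otimes d'')\bullet(b'\otimes b''):=(d'\otimes b')\otimes(d''\otimes b'')$, extended bilinearly. Diassociative algebra $(D,\dashv,\vdash)$: two associative bilinear products on $D$ with $(d_1\dashv d_2)\dashv d_3=d_1\dashv(d_2\vdash d_3)$, $(d_1\vdash d_2)\dashv d_3=d_1\vdash(d_2\dashv d_3)$, $(d_1\dashv d_2)\vdash d_3=(d_1\vdash d_2)\vdash d_3$. Write $\mathbf l_{\dashv}(d)(x)=d\dashv x$, $\mathbf r_{\dashv}(d)(x)=x\dashv d$, $\mathbf l_{\vdash}(d)(x)=d\vdash x$, $\mathbf r_{\vdash}(d)(x)=x\vdash d$. Diassociative coalgebra $(D,\theta_\dashv,\theta_\vdash)$: $\theta_\dashv,\theta_\vdash:D\to D\otimes D$ coassociative with $(\theta_\dashv\otimes\mathrm{id})\theta_\dashv=(\mathrm{id}\otimes\theta_\vdash)\theta_\dashv$, $(\theta_\vdash\otimes\mathrm{id})\theta_\dashv=(\mathrm{id}\otimes\theta_\dashv)\theta_\vdash$, $(\theta_\dashv\otimes\mathrm{id})\theta_\vdash=(\theta_\vdash\otimes\mathrm{id})\theta_\vdash$. Diassociative bialgebra: both structures on $D$ such that for all $d_1,d_2\in D$: (1) $(\mathrm{id}\otimes\mathbf l_\dashv(d_1))\theta_\dashv(d_2)=(\mathbf r_\vdash(d_2)\otimes\mathrm{id})\theta_\vdash(d_1)$; (2) $(\mathbf l_\dashv(d_1)\otimes\mathrm{id})\theta_\vdash(d_2)=(\mathrm{id}\otimes\mathbf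 l_\dashv(d_2))\tau\theta_\vdash(d_1)$; (3) $(\mathbf r_\vdash(d_1)\otimes\mathrm{id})\tau\theta_\dashv(d_2)=(\mathrm{id}\otimes\mathbf r_\vdash(d_2))\theta_\dashv(d_1)$; (4) $\theta_\vdash(d_1\vdash d_2)=(\mathrm{id}\otimes\mathbf l_\vdash(d_1))\theta_\vdash(d_2)-((\mathbf r_\vdash-\mathbf r_\dashv)(d_2)\otimes\mathrm{id})(\theta_\vdash-\theta_\dashv)(d_1)$; (5) $\theta_\vdash(d_1\dashv d_2)=(\mathrm{id}\otimes\mathbf l_\dashv(d_1))(\theta_\vdash-\theta_\dashv)(d_2)+(\mathbf r_\dashv(d_2)\otimes\mathrm{id})\theta_\vdash(d_1)$; (6) $\theta_\dashv(d_1\vdash d_2)=(\mathrm{id}\otimes(\mathbf l_\vdash-\mathbf l_\dashv)(d_1))\theta_\dashv(d_2)+(\mathbf r_\vdash(d_2)\otimes\mathrm{id})\theta_\dashv(d_1)$; (7) $\theta_\dashv(d_1\dashv d_2)=(\mathbf r_\dashv(d_2)\otimes\mathrm{id})\theta_\dashv(d_1)-(\mathrm{id}\otimes(\mathbf l_\vdash-\mathbf l_\dashv)(d_1))(\theta_\vdash-\theta_\dashv)(d_2)$; (8) $((\mathbf l_\vdash-\mathbf l_\dashv)(d_1)\otimes\mathrm{id})\theta_\vdash(d_2)+(\mathrm{id}\otimes\mathbf l_\dashv(d_2))\tau\theta_\dashv(d_1)=((\mathbf r_\vdash-\mathbf r_\dashv)(d_2)\otimes\mathrm{id})\tau(\theta_\vdash-\theta_\dashv)(d_1)+(\mathrm{id}\otimes\mathbf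 r_\dashv(d_1))\theta_\vdash(d_2)$; (9) $(\mathbf r_\dashv(d_1)\otimes\mathrm{id})\tau\theta_\dashv(d_2)+(\mathrm{id}\otimes\mathbf r_\vdash(d_2))(\theta_\vdash-\theta_\dashv)(d_1)=((\mathbf l_\vdash-\mathbf l_\dashv)(d_2)\otimes\mathrm{id})(\theta_\vdash-\theta_\dashv)(d_1)+(\mathrm{id}\otimes\mathbf l_\vdash(d_1))\tau\theta_\dashv(d_2)$. Zinbiel algebra $(B,\diamond)$: $b_1\diamond(b_2\diamond b_3)=(b_1\diamond b_2)\diamond b_3+(b_2\diamond b_1)\diamond b_3$. Quadratic Zinbiel algebra $(B,\diamond,\varpi)$: with a nondegenerate skew-symmetric form $\varpi$ with $\varpi(b_1\diamond b_2,b_3)=\varpi(b_2,b_1\diamond b_3+b_3\diamond b_1)$. $\nu_\varpi:B\to B\otimes B$ is defined by $\varpi(\nu_\varpi(b_1),b_2\otimes b_3)=\varpi(b_1,b_2\diamond b_3)$, where $\varpi(a\otimes b,a'\otimes b')=\varpi(a,a')\varpi(b,b')$. It is known that construction (I) gives an ASI bialgebra and then a Lie bialgebra, and that construction (II) gives a Leibniz bialgebra and then a Lie bialgebra. Here: an ASI bialgebra is an associative algebra $(A,\cdot)$ with coassociative $\Delta$ such that $\Delta(a_1\cdot a_2)=(\mathbf r_A(a_2)\otimes\mathrm{id})\Delta(a_1)+(\mathrm{id}\otimes\mathbf l_A(a_1))\Delta(a_2)$ and $(\mathbf l_A(a_1)\otimes\mathrm{id}-\mathrm{id}\otimes\mathbf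 r_A(a_1))\Delta(a_2)=\tau\big((\mathrm{id}\otimes\mathbf r_A(a_2)-\mathbf l_A(a_2)\otimes\mathrm{id})\Delta(a_1)\big)$, with $\mathbf l_A,\mathbf r_A$ left and right multiplications. A (left) Leibniz algebra $(L,\ast)$ satisfies $x_1\ast(x_2\ast x_3)=(x_1\ast x_2)\ast x_3+x_2\ast(x_1\ast x_3)$; a Leibniz coalgebra $(L,\vartheta)$ satisfies $(\mathrm{id}\otimes\vartheta)\vartheta-(\tau\otimes\mathrm{id})(\mathrm{id}\otimes\vartheta)\vartheta=(\vartheta\otimes\mathrm{id})\vartheta$; a Leibniz bialgebra has both structures with, for $\tilde{\mathbf l}(x)(y)=x\ast y$, $\tilde{\mathbf r}(x)(y)=y\ast x$: $\tau((\tilde{\mathbf r}(x_2)\otimes\mathrm{id})\vartheta(x_1))=(\tilde{\mathbf r}(x_1)\otimes\mathrm{id})\vartheta(x_2)$ and $\vartheta(x_1\ast x_2)=(\mathrm{id}\otimes\tilde{\mathbf r}(x_2)-(\tilde{\mathbf l}+\tilde{\mathbf r})(x_2)\otimes\mathrm{id})(\mathrm{id}\otimes\mathrm{id}+\tau)\vartheta(x_1)+(\mathrm{id}\otimes\tilde{\mathbf l}(x_1)+\tilde{\mathbf l}(x_1)\otimes\mathrm{id})\vartheta(x_2)$. A Lie bialgebra is a Lie algebra and Lie coalgebra with the usual 1-cocycle compatibility. *)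

(* Defs.v *)
From HB Require Import structures.
From mathcomp Require Import all_boot all_order all_algebra.

Set Implicit Arguments.
Unset Strict Implicit.
Unset Printing Implicit Defensive.

Import GRing.Theory.
Local Open Scope ring_scope.

(* MathComp has no tensor product of vector spaces.  U ⊗ V is modelled by      *)
(* coordinate matrices with respect to the canonical bases vbasis {:U} and     *)
(* vbasis {:V}; tlift_tens, tlift_linear and tens_eq_linear below give its     *)
(* universal property.                                                         *)
Definition tprod (k : fieldType) (U V : vectType k) : vectType k :=
  'M[k]_(\dim {:U}, \dim {:V}).
Arguments tprod [k] (U V)%_type.

Definition tens (k : fieldType) (U V : vectType k) (u : U) (v : V) :
    tprod U V :=
  \matrix_(i, j) (coord (vbasis {:U}) i u * coord (vbasis {:V}) j v).

Notation "U ⊗ V" := (tprod U V) (at level 35, right associativity) : type_scope.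
Notation "u ⊗ v" := (tens u v) (at level 35, right associativity) : ring_scope.

(* The linear map sending u ⊗ v to f u v, for f bilinear; every extension      *)
(* by (bi)linearity below goes through it.                                     *)
Definition tlift (k : fieldType) (U V W : vectType k) (f : U -> V -> W)
    (t : U ⊗ V) : W :=
  \sum_i \sum_j (t : 'M_(_, _)) i j *: f (vbasis {:U})`_i (vbasis {:V})`_j.

Definition tlift2 (k : fieldType) (U1 V1 U2 V2 W : vectType k)
    (f : U1 -> V1 -> U2 -> V2 -> W) (s : U1 ⊗ V1) (t : U2 ⊗ V2) :
    W :=
  tlift (fun u1 v1 => tlift (fun u2 v2 => f u1 v1 u2 v2) t) s.

Definition tmap (k : fieldType) (U V U' V' : vectType k)
    (f : U -> U') (g : V -> V') : U ⊗ V -> U' ⊗ V' :=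
  tlift (fun u v => f u ⊗ g v).

Definition tswap (k : fieldType) (U V : vectType k) :
    U ⊗ V -> V ⊗ U :=
  tlift (fun u v => v ⊗ u).

Definition tassoc (k : fieldType) (U V W : vectType k) :
    U ⊗ (V ⊗ W) -> (U ⊗ V) ⊗ W :=
  tlift (fun u t => tlift (fun v w => (u ⊗ v) ⊗ w) t).

Definition bullet (k : fieldType) (D B : vectType k) :
    D ⊗ D -> B ⊗ B -> (D ⊗ B) ⊗ (D ⊗ B) :=
  tlift2 (fun d' d'' b' b'' => (d' ⊗ b') ⊗ (d'' ⊗ b'')).

Definition tform (k : fieldType) (B : vectType k) (w : B -> B -> k)
    (s t : B ⊗ B) : k :=
  tlift2 (W := k^o) (fun a b a' b' => w a a' * w b b') s t.

(* Prop-valued counterpart of MathComp's bilinear_for *:%R *:%R. *)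
Definition is_bilinear (k : fieldType) (U V W : vectType k)
    (f : U -> V -> W) : Prop :=
  (forall v, linear (f^~ v)) /\ (forall u, linear (f u)).

Definition coassociative (k : fieldType) (V : vectType k)
    (Delta : V -> V ⊗ V) : Prop :=
  forall x, tmap Delta id (Delta x) = tassoc (tmap id Delta (Delta x)).

(* In all records below dl is ⊣, dr is ⊢, tl is θ_⊣ and tr is θ_⊢; left        *)
(* multiplication by d is (dl d), right multiplication by d is (dl^~ d).       *)

Record diassociative_algebra (k : fieldType) (D : vectType k)
    (dl dr : D -> D -> D) : Prop := DiassociativeAlgebra {
  dia_dl_bilinear : is_bilinear dl;
  dia_dr_bilinear : is_bilinear dr;
  dia_dlA : forall d1 d2 d3, dl (dl d1 d2) d3 = dl d1 (dl d2 d3);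
  dia_drA : forall d1 d2 d3, dr (dr d1 d2) d3 = dr d1 (dr d2 d3);
  dia_inner_l : forall d1 d2 d3, dl (dl d1 d2) d3 = dl d1 (dr d2 d3);
  dia_mixed : forall d1 d2 d3, dl (dr d1 d2) d3 = dr d1 (dl d2 d3);
  dia_inner_r : forall d1 d2 d3, dr (dl d1 d2) d3 = dr (dr d1 d2) d3
}.

Record diassociative_coalgebra (k : fieldType) (D : vectType k)
    (tl tr : D -> D ⊗ D) : Prop := DiassociativeCoalgebra {
  codia_tl_linear : linear tl;
  codia_tr_linear : linear tr;
  codia_tlA : coassociative tl;
  codia_trA : coassociative tr;
  codia_inner_l : forall d,
    tmap tl id (tl d) = tassoc (tmap id tr (tl d));
  codia_mixed : forall d,
    tmap tr id (tl d) = tassoc (tmap id tl (tr d));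
  codia_inner_r : forall d,
    tmap tl id (tr d) = tmap tr id (tr d)
}.

Record diassociative_bialgebra (k : fieldType) (D : vectType k)
    (dl dr : D -> D -> D) (tl tr : D -> D ⊗ D) : Prop :=
  DiassociativeBialgebra {
  dib_algebra : diassociative_algebra dl dr;
  dib_coalgebra : diassociative_coalgebra tl tr;
  dib1 : forall d1 d2,
    tmap id (dl d1) (tl d2) = tmap (dr^~ d2) id (tr d1);
  dib2 : forall d1 d2,
    tmap (dl d1) id (tr d2) = tmap id (dl d2) (tswap (tr d1));
  dib3 : forall d1 d2,
    tmap (dr^~ d1) id (tswap (tl d2)) = tmap id (dr^~ d2) (tl d1);
  dib4 : forall d1 d2,
    tr (dr d1 d2) =
      tmap id (dr d1) (tr d2)
      - tmap (dr^~ d2 \- dl^~ d2) id (tr d1 - tl d1);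
  dib5 : forall d1 d2,
    tr (dl d1 d2) =
      tmap id (dl d1) (tr d2 - tl d2) + tmap (dl^~ d2) id (tr d1);
  dib6 : forall d1 d2,
    tl (dr d1 d2) =
      tmap id (dr d1 \- dl d1) (tl d2) + tmap (dr^~ d2) id (tl d1);
  dib7 : forall d1 d2,
    tl (dl d1 d2) =
      tmap (dl^~ d2) id (tl d1)
      - tmap id (dr d1 \- dl d1) (tr d2 - tl d2);
  dib8 : forall d1 d2,
    tmap (dr d1 \- dl d1) id (tr d2) + tmap id (dl d2) (tswap (tl d1)) =
      tmap (dr^~ d2 \- dl^~ d2) id (tswap (tr d1 - tl d1))
      + tmap id (dl^~ d1) (tr d2);
  dib9 : forall d1 d2,
    tmap (dl^~ d1) id (tswap (tl d2)) + tmap id (dr^~ d2) (tr d1 - tl d1) =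
      tmap (dr d2 \- dl d2) id (tr d1 - tl d1)
      + tmap id (dr d1) (tswap (tl d2))
}.

Record zinbiel_algebra (k : fieldType) (B : vectType k)
    (z : B -> B -> B) : Prop := ZinbielAlgebra {
  zin_bilinear : is_bilinear z;
  zin_axiom : forall b1 b2 b3,
    z b1 (z b2 b3) = z (z b1 b2) b3 + z (z b2 b1) b3
}.

Record quadratic_zinbiel (k : fieldType) (B : vectType k)
    (z : B -> B -> B) (w : B -> B -> k) : Prop := QuadraticZinbiel {
  qz_zinbiel : zinbiel_algebra z;
  qz_scalarl : forall b, scalar (w^~ b);
  qz_scalarr : forall b, scalar (w b);
  qz_skew : forall b1 b2, w b1 b2 = - w b2 b1;
  qz_nondegenerate : forall b, (forall b', w b b' = 0) -> b = 0;
  qz_invariant : forall b1 b2 b3, w (z b1 b2) b3 = w b2 (z b1 b3 + z b3 b1)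
}.

(* By quadratic_nu_unique and quadratic_nu_exists below, this determines ν_ϖ. *)
Definition is_nu (k : fieldType) (B : vectType k) (z : B -> B -> B)
    (w : B -> B -> k) (nu : B -> B ⊗ B) : Prop :=
  forall b1 b2 b3, tform w (nu b1) (b2 ⊗ b3) = w b1 (z b2 b3).

Record asi_bialgebra (k : fieldType) (A : vectType k) (m : A -> A -> A)
    (Delta : A -> A ⊗ A) : Prop := AsiBialgebra {
  asi_bilinear : is_bilinear m;
  asi_assoc : forall a1 a2 a3, m (m a1 a2) a3 = m a1 (m a2 a3);
  asi_linear : linear Delta;
  asi_coassoc : coassociative Delta;
  asi_cocycle : forall a1 a2,
    Delta (m a1 a2) =
      tmap (m^~ a2) id (Delta a1) + tmap id (m a1) (Delta a2);
  asi_compat : forall a1 a2,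
    tmap (m a1) id (Delta a2) - tmap id (m^~ a1) (Delta a2) =
      tswap (tmap id (m^~ a2) (Delta a1) - tmap (m a2) id (Delta a1))
}.

Record leibniz_algebra (k : fieldType) (L : vectType k)
    (m : L -> L -> L) : Prop := LeibnizAlgebra {
  leib_bilinear : is_bilinear m;
  leib_axiom : forall x1 x2 x3,
    m x1 (m x2 x3) = m (m x1 x2) x3 + m x2 (m x1 x3)
}.

(* The term (τ ⊗ id)(id ⊗ ϑ)ϑ is read in (L ⊗ L) ⊗ L, like the others. *)
Definition coleibniz (k : fieldType) (L : vectType k)
    (th : L -> L ⊗ L) : Prop :=
  forall x,
    tassoc (tmap id th (th x))
    - tmap (@tswap k L L) id (tassoc (tmap id th (th x)))
    = tmap th id (th x).

Record leibniz_coalgebra (k : fieldType) (L : vectType k)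
    (th : L -> L ⊗ L) : Prop := LeibnizCoalgebra {
  coleib_linear : linear th;
  coleib_axiom : coleibniz th
}.

Record leibniz_bialgebra (k : fieldType) (L : vectType k)
    (m : L -> L -> L) (th : L -> L ⊗ L) : Prop := LeibnizBialgebra {
  leibbi_algebra : leibniz_algebra m;
  leibbi_coalgebra : leibniz_coalgebra th;
  leibbi_sym : forall x1 x2,
    tswap (tmap (m^~ x2) id (th x1)) = tmap (m^~ x1) id (th x2);
  leibbi_cocycle : forall x1 x2,
    th (m x1 x2) =
      (tmap id (m^~ x2) (th x1 + tswap (th x1))
       - tmap (m x2 \+ m^~ x2) id (th x1 + tswap (th x1)))
      + (tmap id (m x1) (th x2) + tmap (m x1) id (th x2))
}.

Record lie_algebra (k : fieldType) (L : vectType k)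
    (br : L -> L -> L) : Prop := LieAlgebra {
  lie_bilinear : is_bilinear br;
  lie_alternating : forall x, br x x = 0;
  lie_jacobi : forall x y z,
    br x (br y z) + br y (br z x) + br z (br x y) = 0
}.

(* For a skew-symmetric cobracket the co-Jacobi identity is coleibniz. *)
Record lie_coalgebra (k : fieldType) (L : vectType k)
    (delta : L -> L ⊗ L) : Prop := LieCoalgebra {
  colie_linear : linear delta;
  colie_skew : forall x, tswap (delta x) = - delta x;
  colie_jacobi : coleibniz delta
}.

Record lie_bialgebra (k : fieldType) (L : vectType k)
    (br : L -> L -> L) (delta : L -> L ⊗ L) : Prop := LieBialgebra {
  liebi_algebra : lie_algebra br;
  liebi_coalgebra : lie_coalgebra delta;
  liebi_cocycle : forall x y,
    delta (br x y) =
      (tmap (br x) id (delta y) + tmap id (br x) (delta y))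
      - (tmap (br y) id (delta x) + tmap id (br y) (delta x))
}.

Definition asi_mul (k : fieldType) (D B : vectType k) (dl dr : D -> D -> D)
    (z : B -> B -> B) : D ⊗ B -> D ⊗ B -> D ⊗ B :=
  tlift2 (fun d1 b1 d2 b2 => dr d1 d2 ⊗ z b1 b2 + dl d1 d2 ⊗ z b2 b1).

Definition asi_comul (k : fieldType) (D B : vectType k)
    (tl tr : D -> D ⊗ D) (nu : B -> B ⊗ B) :
    D ⊗ B -> (D ⊗ B) ⊗ (D ⊗ B) :=
  tlift (fun d b => bullet (tr d) (nu b) + bullet (tl d) (tswap (nu b))).

Definition commutator_bracket (k : fieldType) (A : vectType k)
    (m : A -> A -> A) (a1 a2 : A) : A := m a1 a2 - m a2 a1.

Definition commutator_cobracket (k : fieldType) (A : vectType k)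
    (Delta : A -> A ⊗ A) (a : A) : A ⊗ A :=
  Delta a - tswap (Delta a).

Definition leib_mul (k : fieldType) (D : vectType k) (dl dr : D -> D -> D)
    (d1 d2 : D) : D := dr d1 d2 - dl d2 d1.

Definition leib_comul (k : fieldType) (D : vectType k)
    (tl tr : D -> D ⊗ D) (d : D) : D ⊗ D :=
  tr d - tswap (tl d).

Definition leib_lie_bracket (k : fieldType) (D B : vectType k)
    (m : D -> D -> D) (z : B -> B -> B) :
    D ⊗ B -> D ⊗ B -> D ⊗ B :=
  tlift2 (fun d1 b1 d2 b2 => m d1 d2 ⊗ z b1 b2 - m d2 d1 ⊗ z b2 b1).

Definition leib_lie_cobracket (k : fieldType) (D B : vectType k)
    (th : D -> D ⊗ D) (nu : B -> B ⊗ B) :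
    D ⊗ B -> (D ⊗ B) ⊗ (D ⊗ B) :=
  tlift (fun d b => bullet (th d) (nu b) - tswap (bullet (th d) (nu b))).

Lemma tens_bilinear (k : fieldType) (U V : vectType k) :
  is_bilinear (@tens k U V).
Proof.
split=> [v a u u' | u a v v']; apply/matrixP=> i j; rewrite !mxE linearP /=.
  by rewrite mulrDl mulrA.
by rewrite mulrDr mulrCA.
Qed.

Lemma tlift_linear (k : fieldType) (U V W : vectType k) (f : U -> V -> W) :
  linear (tlift f).
Proof.
move=> a s t; rewrite /tlift scaler_sumr -big_split /=; apply: eq_bigr => i _.
rewrite scaler_sumr -big_split /=; apply: eq_bigr => j _.
by rewrite !mxE scalerDl scalerA.
Qed.

Lemma linear_sum_coord (k : fieldType) (U W : vectType k) (f : U -> W) u :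
  linear f ->
  f u = \sum_i coord (vbasis {:U}) i u *: f (vbasis {:U})`_i.
Proof.
move=> lf; pose F : {linear U -> W} := HB.pack f
  (GRing.isLinear.Build _ _ _ _ f lf).
rewrite -[f]/(F : U -> W) {1}(coord_vbasis (memvf u)) linear_sum /=.
by apply: eq_bigr => i _; rewrite -[f]/(F : U -> W) linearZ.
Qed.

Lemma tlift_tens (k : fieldType) (U V W : vectType k) (f : U -> V -> W) u v :
  is_bilinear f -> tlift f (u ⊗ v) = f u v.
Proof.
case=> fl fr; rewrite [RHS](linear_sum_coord u (fl v)).
apply: eq_bigr => i _; rewrite (linear_sum_coord v (fr _)) scaler_sumr.
by apply: eq_bigr => j _; rewrite mxE scalerA.
Qed.

Lemma tens_sum (k : fieldType) (U V : vectType k) (t : U ⊗ V) :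
  t = tlift (@tens k U V) t.
Proof.
have fr (X : vectType k) : free (vbasis {:X}).
  exact: basis_free (vbasisP _).
apply/matrixP=> i j.
pose f (s : U ⊗ V) : k := (s : 'M_(_, _)) i j.
have lf : scalar f by move=> a s s'; rewrite /f !mxE.
pose F : {scalar (U ⊗ V)%type} := HB.pack f (GRing.isLinear.Build _ _ _ _ f lf).
have -> : (tlift (@tens k U V) t : 'M_(_, _)) i j =
    \sum_i' \sum_j' (t : 'M_(_, _)) i' j' *
      f ((vbasis {:U})`_i' ⊗ (vbasis {:V})`_j').
  rewrite -[LHS]/(F (tlift (@tens k U V) t)) /tlift linear_sum.
  apply: eq_bigr => i' _; rewrite linear_sum; apply: eq_bigr => j' _.
  by rewrite linearZ.
rewrite /f (bigD1 i) //= [X in _ + X]big1 ?addr0 => [|i' ni].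
  rewrite (bigD1 j) //= big1 ?addr0 => [|j' nj].
    by rewrite !mxE !coord_free // !eqxx !mulr1.
  by rewrite !mxE !coord_free // (negbTE nj) !mulr0.
rewrite big1 // => j' _.
by rewrite !mxE !coord_free // (negbTE ni) mul0r mulr0.
Qed.

Lemma tens_eq_linear (k : fieldType) (U V W : vectType k)
    (f g : U ⊗ V -> W) :
  linear f -> linear g -> (forall u v, f (u ⊗ v) = g (u ⊗ v)) ->
  forall t, f t = g t.
Proof.
move=> lf lg fg t.
pose F : {linear (U ⊗ V)%type -> W} := HB.pack f
  (GRing.isLinear.Build _ _ _ _ f lf).
pose G : {linear (U ⊗ V)%type -> W} := HB.pack g
  (GRing.isLinear.Build _ _ _ _ g lg).
rewrite -[f]/(F : _ -> W) -[g]/(G : _ -> W) (tens_sum t) /tlift !linear_sum.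
apply: eq_bigr => i _; rewrite !linear_sum; apply: eq_bigr => j _.
by rewrite !linearZ; congr (_ *: _); exact: fg.
Qed.

Lemma tform_tens (k : fieldType) (B : vectType k) (w : B -> B -> k)
    (t : B ⊗ B) b1 b2 :
  (forall b, scalar (w b)) ->
  tform w t (b1 ⊗ b2) =
    \sum_i \sum_j (t : 'M_(_, _)) i j *
      (w (vbasis {:B})`_i b1 * w (vbasis {:B})`_j b2).
Proof.
move=> wr; apply: eq_bigr => i _; apply: eq_bigr => j _; congr (_ * _).
rewrite tlift_tens //; split=> [v a u u' | u a v v'] /=.
  by rewrite wr mulrDl -mulrA.
by rewrite wr mulrDr mulrCA.
Qed.

Definition gram (k : fieldType) (B : vectType k) (w : B -> B -> k) :
    'M[k]_(\dim {:B}) :=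
  \matrix_(i, j) w (vbasis {:B})`_i (vbasis {:B})`_j.

Lemma tform_basis (k : fieldType) (B : vectType k) (w : B -> B -> k)
    (t : B ⊗ B) (i j : 'I_(\dim {:B})) :
  (forall b, scalar (w b)) ->
  tform w t ((vbasis {:B})`_i ⊗ (vbasis {:B})`_j) =
    ((gram w)^T *m (t : 'M_(_, _)) *m gram w) i j.
Proof.
move=> wr; rewrite tform_tens // !mxE exchange_big; apply: eq_bigr => j' _.
rewrite !mxE mulr_suml; apply: eq_bigr => i' _.
by rewrite !mxE mulrA; congr (_ * _); rewrite mulrC.
Qed.

Lemma gram_unit (k : fieldType) (B : vectType k) (w : B -> B -> k) :
  (forall b, scalar (w^~ b)) -> (forall b, scalar (w b)) ->
  (forall b, (forall b', w b b' = 0) -> b = 0) ->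
  gram w \in unitmx.
Proof.
move=> wl wr nd; rewrite -row_free_unit -kermx_eq0; apply/eqP/row_matrixP=> r.
rewrite row0; set v := row r _.
have vG : v *m gram w = 0 by rewrite -row_mul mulmx_ker row0.
move: v vG => v vG.
pose b := \sum_i v 0 i *: (vbasis {:B})`_i.
have wE (c : 'I_(\dim {:B}) -> k) (f : B -> k) : scalar f ->
    f (\sum_i c i *: (vbasis {:B})`_i) =
    \sum_(i < \dim {:B}) c i * f (vbasis {:B})`_i.
  move=> lf; pose F : {scalar B} := HB.pack f
    (GRing.isLinear.Build _ _ _ _ f lf).
  rewrite -[f]/(F : B -> k) linear_sum; apply: eq_bigr => i _.
  by rewrite linearZ.
have b0 : b = 0.
  apply: nd => b'; rewrite (coord_vbasis (memvf b')) wE // big1 // => j _.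
  rewrite (wE _ (w^~ _)) //.
  have /matrixP/(_ 0 j) := vG; rewrite !mxE.
  under eq_bigr => i _ do rewrite mxE.
  by move=> ->; rewrite mulr0.
apply/rowP=> i; rewrite [RHS]mxE.
have := coord_sum_free (v 0) i (basis_free (vbasisP {:B})).
by rewrite -/b b0 linear0 => <-.
Qed.

Lemma quadratic_nu_unique (k : fieldType) (B : vectType k)
    (z : B -> B -> B) (w : B -> B -> k) (nu nu' : B -> B ⊗ B) :
  quadratic_zinbiel z w -> is_nu z w nu -> is_nu z w nu' -> nu =1 nu'.
Proof.
case=> _ wl wr _ nd _ nuP nuP' b.
have uG := gram_unit wl wr nd; have uGt : (gram w)^T \in unitmx.
  by rewrite unitmx_tr.
apply: (can_inj (mulKmx uGt)); apply: (can_inj (mulmxK uG)).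
by apply/matrixP=> i j; rewrite -!tform_basis // nuP nuP'.
Qed.

Lemma quadratic_nu_exists (k : fieldType) (B : vectType k)
    (z : B -> B -> B) (w : B -> B -> k) :
  quadratic_zinbiel z w -> exists nu : B -> B ⊗ B, is_nu z w nu.
Proof.
case=> -[[zl zr] _] wl wr _ nd _.
have uG := gram_unit wl wr nd; have uGt : (gram w)^T \in unitmx.
  by rewrite unitmx_tr.
pose N b : 'M[k]_(\dim {:B}) :=
  \matrix_(i, j) w b (z (vbasis {:B})`_i (vbasis {:B})`_j).
exists (fun b => invmx (gram w)^T *m N b *m invmx (gram w)) => b b2 b3.
set t := (X in tform w X _).
have tE (i j : 'I_(\dim {:B})) :
    tform w t ((vbasis {:B})`_i ⊗ (vbasis {:B})`_j) =
    w b (z (vbasis {:B})`_i (vbasis {:B})`_j).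
  by rewrite tform_basis // /t !mulmxA mulmxKV // mulmxV // mul1mx mxE.
have extend (f : B -> B -> k) c c' : (forall v, scalar (f^~ v)) ->
    (forall u, scalar (f u)) ->
    f c c' = tlift (W := k^o) f (c ⊗ c').
  by move=> fl fr; rewrite tlift_tens.
rewrite (extend (fun u v => tform w t (u ⊗ v))); first last.
- move=> u a v v'; rewrite !tform_tens // mulr_sumr -big_split /=.
  apply: eq_bigr => i _; rewrite mulr_sumr -big_split /=.
  by apply: eq_bigr => j _; rewrite wr !mulrDr !(mulrCA a).
- move=> v a u u'; rewrite !tform_tens // mulr_sumr -big_split /=.
  apply: eq_bigr => i _; rewrite mulr_sumr -big_split /=.
  by apply: eq_bigr => j _; rewrite wr mulrDl mulrDr -mulrA !(mulrCA a).
rewrite (extend (fun u v => w b (z u v))).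
- by apply: eq_bigr => i _; apply: eq_bigr => j _; rewrite tE.
- by move=> v a u u'; rewrite zl wr.
- by move=> u a v v'; rewrite zr wr.
Qed.

(* Main.v *)
Require Import Defs.
From HB Require Import structures.
From mathcomp Require Import all_boot all_order all_algebra ring.
From Stdlib Require Import FunctionalExtensionality.

Set Implicit Arguments.
Unset Strict Implicit.
Unset Printing Implicit Defensive.

Import GRing.Theory.
Local Open Scope ring_scope.

(* Every tensor identity is tested on tensor products of functionals.  The     *)
(* comultiplications then become convolution products on functionals, for      *)
(* which the coalgebra axioms are algebra axioms and the compatibilities (1)-  *)
(* (9) are scalar identities.  On D ⊗ B the functionals f ⊗ ϖ(-, c) suffice,   *)
(* ϖ being nondegenerate.  Since the adjoints of left and right                *)
(* multiplication by b in B are L_b + R_b and - R_b, every scalar produced     *)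
(* from B reduces to a combination of the six values ϖ(b1, (xy)z), x, y, z     *)
(* running over the orders of the other three arguments.  Comparing the        *)
(* coefficients of these six values leaves linear consequences of (1)-(9).     *)

(** The two brackets agree by regrouping: in the commutator of pure tensors, b1 ⋄ b2 collects d1 ⊢
    d2 - d2 ⊣ d1, and b2 ⋄ b1 collects the negative of the same expression with d1 and d2 exchanged.
    The cobrackets agree because τ(s • t) = τs • τt lets the flip pass from ν to θ_⊣. By
    [commutator_bracket_leib] and [commutator_cobracket_leib] only one Lie bialgebra has to be
    verified, and it is the commutator of an ASI bialgebra ([asi_lie_bialgebra]).

    The form ϖ identifies B with its dual and turns ν into ⋄. Hence the coproduct on D ⊗ B is dual
    to a product of the shape of [asi_mul], built from the diassociative algebra dual to D
    ([dual_asi_comul]), and coassociativity is the same calculation as associativity. In the mixed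
    axioms, [form_mull] and [form_mulr] reduce the B-side to six values. Their coefficients cancel
    by (1), (4)-(7) in the cocycle identity ([asi_mul_cocycle]) and by (2), (3), (8), (9) in the
    symmetry condition ([asi_mul_compat]). The Leibniz bialgebra on D comes from the nine identities
    directly ([leibniz_bialgebra_leib]). *)

Section LinearMaps.
Variable k : fieldType.
Implicit Types U V W X : vectType k.

(** * Linear maps, product functionals and separating families *)

Lemma lin_comp U V W (f : V -> W) (g : U -> V) :
  linear f -> linear g -> linear (fun x => f (g x)).
Proof. by move=> lf lg a u v; rewrite lg lf. Qed.

Lemma lin_add U V (f g : U -> V) :
  linear f -> linear g -> linear (fun x => f x + g x).
Proof. by move=> lf lg a u v; rewrite lf lg scalerDr addrACA. Qed.

Lemma lin_opp U V (f : U -> V) : linear f -> linear (fun x => - f x).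
Proof. by move=> lf a u v; rewrite lf opprD scalerN. Qed.

Lemma lin_sub U V (f g : U -> V) :
  linear f -> linear g -> linear (fun x => f x - g x).
Proof. by move=> lf lg; apply: lin_add => //; apply: lin_opp. Qed.

Lemma lin_add_eq U V (f : U -> V) : linear f -> {morph f : x y / x + y}.
Proof. by move=> lf x y; rewrite -[x]scale1r lf !scale1r. Qed.

Lemma lin_zero U V (f : U -> V) : linear f -> f 0 = 0.
Proof.
by move=> lf; apply: (addrI (f 0)); rewrite -(lin_add_eq lf) !addr0.
Qed.

Lemma lin_opp_eq U V (f : U -> V) : linear f -> {morph f : x / - x}.
Proof.
move=> lf x; apply: (addrI (f x)).
by rewrite -(lin_add_eq lf) !subrr (lin_zero lf).
Qed.

Lemma lin_sub_eq U V (f : U -> V) : linear f -> {morph f : x y / x - y}.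
Proof. by move=> lf x y; rewrite (lin_add_eq lf) (lin_opp_eq lf). Qed.

Lemma lin_scale_eq U V (f : U -> V) a x : linear f -> f (a *: x) = a *: f x.
Proof. by move=> lf; have := lf a x 0; rewrite !addr0 (lin_zero lf) addr0. Qed.

Lemma lin_sum U V (f : U -> V) (I : finType) (x : I -> U) :
  linear f -> f (\sum_i x i) = \sum_i f (x i).
Proof.
by move=> lf; apply: big_morph; [apply: lin_add_eq | apply: lin_zero].
Qed.

Lemma lin_tlift U V W X (F : X -> U -> V -> W) (t : U ⊗ V) :
  (forall u v, linear (fun x => F x u v)) ->
  linear (fun x => tlift (F x) t).
Proof.
move=> lF a x y; rewrite /tlift scaler_sumr -big_split /=.
apply: eq_bigr => i _; rewrite scaler_sumr -big_split /=.
by apply: eq_bigr => j _; rewrite lF scalerDr !scalerA mulrC.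
Qed.

Lemma eq_tlift U V W (F G : U -> V -> W) (t : U ⊗ V) :
  (forall u v, F u v = G u v) -> tlift F t = tlift G t.
Proof.
by move=> E; apply: eq_bigr => i _; apply: eq_bigr => j _; rewrite E.
Qed.

Lemma tlift_lin U V W X (h : W -> X) (F : U -> V -> W) (t : U ⊗ V) :
  linear h -> h (tlift F t) = tlift (fun u v => h (F u v)) t.
Proof.
move=> lh; rewrite /tlift lin_sum //; apply: eq_bigr => i _.
by rewrite lin_sum //; apply: eq_bigr => j _; rewrite lin_scale_eq.
Qed.

Lemma lin_tensl U V (v : V) : linear (fun u : U => u ⊗ v).
Proof. by case: (tens_bilinear U V) => l _; apply: l. Qed.

Lemma lin_tensr U V (u : U) : linear (fun v : V => u ⊗ v).
Proof. by case: (tens_bilinear U V) => _ l; apply: l. Qed.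

Lemma lin_tens_compl U V W (F : W -> U) (v : V) :
  linear F -> linear (fun x => F x ⊗ v).
Proof. exact: (lin_comp (lin_tensl v)). Qed.

Lemma lin_tens_compr U V W (u : U) (F : W -> V) :
  linear F -> linear (fun x => u ⊗ F x).
Proof. exact: (lin_comp (lin_tensr u)). Qed.

Lemma tlift2_bilinear U1 V1 U2 V2 W (F : U1 -> V1 -> U2 -> V2 -> W) :
  is_bilinear (tlift2 F).
Proof.
split=> [t|s]; first exact: tlift_linear.
by apply: lin_tlift => u v; apply: tlift_linear.
Qed.

Lemma tlift2_tens U1 V1 U2 V2 W (F : U1 -> V1 -> U2 -> V2 -> W) u1 v1 u2 v2 :
  (forall u v, is_bilinear (F u v)) ->
  (forall u v, is_bilinear (fun x y => F x y u v)) ->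
  tlift2 F (u1 ⊗ v1) (u2 ⊗ v2) = F u1 v1 u2 v2.
Proof.
move=> b2 b1; rewrite /tlift2 tlift_tens; first by rewrite tlift_tens.
by split=> [v|u]; apply: lin_tlift => x y; case: (b1 x y).
Qed.

Lemma tens_eq_bilinear U1 V1 U2 V2 W (f g : U1 ⊗ V1 -> U2 ⊗ V2 -> W) :
  is_bilinear f -> is_bilinear g ->
  (forall u1 v1 u2 v2, f (u1 ⊗ v1) (u2 ⊗ v2) = g (u1 ⊗ v1) (u2 ⊗ v2)) ->
  forall s t, f s t = g s t.
Proof.
move=> [fl fr] [gl gr] E s t; move: s.
apply: (tens_eq_linear (fl t) (gl t)) => u v; move: t.
by apply: (tens_eq_linear (fr _) (gr _)) => u' v'; apply: E.
Qed.

(** The functional f ⊗ g. Here [k^o] is [k] as a vector space over itself, so that functionals fall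
    under the lemmas on linear maps. *)
Definition tpair U V (f : U -> k) (g : V -> k) (t : U ⊗ V) : k :=
  tlift (W := k^o) (fun u v => f u * g v) t.

Lemma scalar_tpair U V (f : U -> k) (g : V -> k) : scalar (tpair f g).
Proof. exact: (tlift_linear (W := k^o)). Qed.

Lemma tpair_add U V (f : U -> k) (g : V -> k) s t :
  tpair f g (s + t) = tpair f g s + tpair f g t.
Proof. exact: (lin_add_eq (V := k^o) (scalar_tpair f g)). Qed.

Lemma tpair_opp U V (f : U -> k) (g : V -> k) t : tpair f g (- t) = - tpair f g t.
Proof. exact: (lin_opp_eq (V := k^o) (scalar_tpair f g)). Qed.

Lemma tpair_sub U V (f : U -> k) (g : V -> k) s t :
  tpair f g (s - t) = tpair f g s - tpair f g t.
Proof. exact: (lin_sub_eq (V := k^o) (scalar_tpair f g)). Qed.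

Lemma scalar_comp U V (f : V -> k) (F : U -> V) :
  scalar f -> linear F -> scalar (f \o F).
Proof. by move=> lf lF a u v /=; rewrite lF lf. Qed.

Lemma eq_tpair U V (f f' : U -> k) (g g' : V -> k) t :
  f =1 f' -> g =1 g' -> tpair f g t = tpair f' g' t.
Proof. by move=> ef eg; apply: (eq_tlift (W := k^o)) => u v; rewrite ef eg. Qed.

Lemma tpair_tens U V (f : U -> k) (g : V -> k) u v :
  scalar f -> scalar g -> tpair f g (u ⊗ v) = f u * g v.
Proof.
move=> lf lg; rewrite /tpair tlift_tens //; split=> [v' a x y|u' a x y] /=.
  by rewrite lf mulrDl -mulrA.
by rewrite lg mulrDr mulrCA.
Qed.

Lemma tpairDl U V (f f' : U -> k) (g : V -> k) t :
  tpair (fun x => f x + f' x) g t = tpair f g t + tpair f' g t.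
Proof.
rewrite /tpair /tlift -big_split; apply: eq_bigr => i _.
by rewrite -big_split; apply: eq_bigr => j _; rewrite mulrDl; apply: mulrDr.
Qed.

Lemma tpairDr U V (f : U -> k) (g g' : V -> k) t :
  tpair f (fun x => g x + g' x) t = tpair f g t + tpair f g' t.
Proof.
rewrite /tpair /tlift -big_split; apply: eq_bigr => i _.
by rewrite -big_split; apply: eq_bigr => j _; rewrite mulrDr; apply: mulrDr.
Qed.

Lemma tpairBl U V (f f' : U -> k) (g : V -> k) t :
  tpair (fun x => f x - f' x) g t = tpair f g t - tpair f' g t.
Proof.
apply/eqP; rewrite eq_sym subr_eq -tpairDl; apply/eqP.
by apply: eq_tpair => // x; rewrite subrK.
Qed.

Lemma tpairBr U V (f : U -> k) (g g' : V -> k) t :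
  tpair f (fun x => g x - g' x) t = tpair f g t - tpair f g' t.
Proof.
apply/eqP; rewrite eq_sym subr_eq -tpairDr; apply/eqP.
by apply: eq_tpair => // x; rewrite subrK.
Qed.

Lemma tpair_tlift U V U' V' (f : U' -> k) (g : V' -> k) F (t : U ⊗ V) :
  tpair f g (tlift F t) = tlift (W := k^o) (fun u v => tpair f g (F u v)) t.
Proof.
by apply: (tlift_lin (X := k^o)); apply: scalar_tpair.
Qed.

Lemma tpair_tmapl U V U' (f : U' -> k) (g : V -> k) F (t : U ⊗ V) :
  scalar f -> scalar g -> tpair f g (tmap F id t) = tpair (f \o F) g t.
Proof.
move=> lf lg; rewrite tpair_tlift.
by apply: (eq_tlift (W := k^o)) => u v; rewrite tpair_tens.
Qed.

Lemma tpair_tmapr U V V' (f : U -> k) (g : V' -> k) F (t : U ⊗ V) :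
  scalar f -> scalar g -> tpair f g (tmap id F t) = tpair f (g \o F) t.
Proof.
move=> lf lg; rewrite tpair_tlift.
by apply: (eq_tlift (W := k^o)) => u v; rewrite tpair_tens.
Qed.

Lemma tpair_tmapDl U V U' (f : U' -> k) (g : V -> k) F G (t : U ⊗ V) :
  scalar f -> scalar g -> tpair f g (tmap (F \+ G) id t) =
  tpair f g (tmap F id t) + tpair f g (tmap G id t).
Proof.
move=> lf lg; rewrite !tpair_tmapl // -tpairDl; apply: eq_tpair => // x /=.
by rewrite (lin_add_eq (V := k^o)).
Qed.

Lemma tpair_tmapBl U V U' (f : U' -> k) (g : V -> k) F G (t : U ⊗ V) :
  scalar f -> scalar g -> tpair f g (tmap (F \- G) id t) =
  tpair (f \o F) g t - tpair (f \o G) g t.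
Proof.
move=> lf lg; rewrite tpair_tmapl // -tpairBl; apply: eq_tpair => // x /=.
by rewrite (lin_sub_eq (V := k^o)).
Qed.

Lemma tpair_tmapBr U V V' (f : U -> k) (g : V' -> k) F G (t : U ⊗ V) :
  scalar f -> scalar g -> tpair f g (tmap id (F \- G) t) =
  tpair f (g \o F) t - tpair f (g \o G) t.
Proof.
move=> lf lg; rewrite tpair_tmapr // -tpairBr; apply: eq_tpair => // x /=.
by rewrite (lin_sub_eq (V := k^o)).
Qed.

Lemma tpair_tswap U V (f : V -> k) (g : U -> k) (t : U ⊗ V) :
  scalar f -> scalar g -> tpair f g (tswap t) = tpair g f t.
Proof.
move=> lf lg; rewrite tpair_tlift.
by apply: (eq_tlift (W := k^o)) => u v; rewrite tpair_tens // mulrC.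
Qed.

Lemma tpair_tassoc U V W (f : U -> k) (g : V -> k) (h : W -> k)
    (t : U ⊗ (V ⊗ W)) :
  scalar f -> scalar g -> scalar h ->
  tpair (tpair f g) h (tassoc t) = tpair f (tpair g h) t.
Proof.
move=> lf lg lh; rewrite tpair_tlift; apply: (eq_tlift (W := k^o)) => u s.
rewrite tpair_tlift [in RHS]/tpair.
rewrite (tlift_lin (W := k^o) (X := k^o) (h := fun x => f u * x)).
  apply: (eq_tlift (W := k^o)) => v w.
  by rewrite !tpair_tens ?mulrA //; apply: scalar_tpair.
by move=> a x y /=; rewrite mulrDr mulrCA.
Qed.

(** Since • interchanges the two middle factors, evaluation on it splits into a scalar from each
    tensor. This separates the D-side from the B-side in every identity on D ⊗ B. *)
Lemma tpair_bullet U V (f g : U -> k) (p q : V -> k) (s : U ⊗ U) (t : V ⊗ V) :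
  scalar f -> scalar g -> scalar p -> scalar q ->
  tpair (tpair f p) (tpair g q) (bullet s t) = tpair f g s * tpair p q t.
Proof.
move=> lf lg lp lq; rewrite /bullet /tlift2 tpair_tlift mulrC.
rewrite [tpair f g s]/tpair.
rewrite (tlift_lin (W := k^o) (X := k^o) (h := fun x => _ * x)); last first.
  by move=> a x y /=; rewrite mulrDr mulrCA.
apply: (eq_tlift (W := k^o)) => u v; rewrite tpair_tlift mulrC.
rewrite [tpair p q t]/tpair.
rewrite (tlift_lin (W := k^o) (X := k^o) (h := fun x => _ * x)); last first.
  by move=> a x y /=; rewrite mulrDr mulrCA.
apply: (eq_tlift (W := k^o)) => b c; rewrite !tpair_tens //; last 2 first.
- exact: scalar_tpair.
- exact: scalar_tpair.
by rewrite mulrACA.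
Qed.

(** Keeping the family [P] abstract allows B to be tested on the functionals ϖ(-, c) alone, on which
    ν is given explicitly. *)
Definition separating U (P : (U -> k) -> Prop) : Prop :=
  (forall f, P f -> scalar f) /\
  (forall u, (forall f, P f -> f u = 0) -> u = 0).

Lemma separating_eq U (P : (U -> k) -> Prop) u v :
  separating P -> (forall f, P f -> f u = f v) -> u = v.
Proof.
case=> sP nP E; apply/eqP; rewrite -subr_eq0; apply/eqP/nP => f Pf.
by rewrite (lin_sub_eq (V := k^o) (sP _ Pf)) E ?subrr.
Qed.

Lemma separating_scalar U : separating (fun f : U -> k => scalar f).
Proof.
split=> // u E; rewrite (coord_vbasis (memvf u)) big1 // => i _.
rewrite (E (coord (vbasis {:U}) i)) ?scale0r // => a x y.
by rewrite linearP.
Qed.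

Inductive tensor_functional U V (P : (U -> k) -> Prop) (Q : (V -> k) -> Prop) :
    (U ⊗ V -> k) -> Prop :=
  TensorFunctional f g of P f & Q g : tensor_functional P Q (tpair f g).

Lemma separating_tens U V (P : (U -> k) -> Prop) (Q : (V -> k) -> Prop) :
  separating P -> separating Q -> separating (tensor_functional P Q).
Proof.
move=> [sP nP] [sQ nQ]; split=> [_ [f g _ _]|t E]; first exact: scalar_tpair.
(* Contracting the second factor of [t] with [g] gives a vector [c] on which [P] vanishes, so [c] is
   zero and [f] may be any linear functional. The next step does the same in the other factor. *)
have El f g : scalar f -> Q g -> tpair f g t = 0.
  move=> lf Qg; pose c := tlift (fun u v => g v *: u) t.
  have cE h : scalar h -> h c = tpair h g t.
    move=> lh; rewrite (tlift_lin (X := k^o)) //.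
    apply: (eq_tlift (W := k^o)) => u v.
    by rewrite (lin_scale_eq (V := k^o)) // mulrC.
  rewrite -cE // (nP c) ?(lin_zero (V := k^o) lf) // => h Ph.
  by rewrite cE ?(E (tpair h g)) //; apply: sP.
have Er f g : scalar f -> scalar g -> tpair f g t = 0.
  move=> lf lg; pose c := tlift (fun u v => f u *: v) t.
  have cE h : scalar h -> h c = tpair f h t.
    move=> lh; rewrite (tlift_lin (X := k^o)) //.
    apply: (eq_tlift (W := k^o)) => u v.
    by rewrite (lin_scale_eq (V := k^o)).
  rewrite -cE // (nQ c) ?(lin_zero (V := k^o) lg) // => h Qh.
  by rewrite cE ?El //; apply: sQ.
have sc (X : vectType k) i : scalar (coord (vbasis {:X}) i).
  by move=> a x y; rewrite linearP.
(* The entries of [t] are its values on products of coordinate functionals. *)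
apply/matrixP=> i j; rewrite [RHS]mxE -(Er _ _ (sc U i) (sc V j)).
rewrite [in LHS](tens_sum t).
have sij : scalar (fun s : U ⊗ V => (s : 'M_(_, _)) i j).
  by move=> a x y; rewrite !mxE.
rewrite (tlift_lin (X := k^o) (h := fun s : U ⊗ V => (s : 'M_(_, _)) i j)) //.
by apply: (eq_tlift (W := k^o)) => u v; rewrite mxE.
Qed.

End LinearMaps.

(** * The convolution product dual to a comultiplication *)

Section DualProduct.
Variables (k : fieldType) (V : vectType k).
Implicit Types (f g h : V -> k) (t : V ⊗ V) (Delta : V -> V ⊗ V).

(** The product on the dual of V obtained by transposing [Delta]. *)
Definition dual_mul Delta f g (x : V) : k := tpair f g (Delta x).

Lemma scalar_dual_mul Delta f g : linear Delta -> scalar (dual_mul Delta f g).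
Proof. by move=> lD; apply: scalar_comp => //; apply: scalar_tpair. Qed.

Lemma tensor_eq t t' :
  (forall f g, scalar f -> scalar g -> tpair f g t = tpair f g t') -> t = t'.
Proof.
move=> E; have sV := separating_scalar V.
apply: (separating_eq (separating_tens sV sV)).
by move=> _ [f g lf lg]; apply: E.
Qed.

Lemma tensor3_eq (s s' : (V ⊗ V) ⊗ V) :
  (forall f g h, scalar f -> scalar g -> scalar h ->
     tpair (tpair f g) h s = tpair (tpair f g) h s') -> s = s'.
Proof.
move=> E; have sV := separating_scalar V.
apply: (separating_eq (separating_tens (separating_tens sV sV) sV)).
by move=> _ [_ h [f g lf lg] lh]; apply: E.
Qed.

Lemma tpair_comulr Delta Delta' f g h x :
  scalar f -> scalar g -> scalar h ->
  tpair (tpair f g) h (tassoc (tmap id Delta (Delta' x))) =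
  dual_mul Delta' f (dual_mul Delta g h) x.
Proof.
move=> lf lg lh; rewrite tpair_tassoc // tpair_tmapr //.
exact: scalar_tpair.
Qed.

Lemma tpair_comull Delta Delta' f g h x :
  scalar f -> scalar g -> scalar h ->
  tpair (tpair f g) h (tmap Delta id (Delta' x)) =
  dual_mul Delta' (dual_mul Delta f g) h x.
Proof.
by move=> lf lg lh; rewrite tpair_tmapl //; apply: scalar_tpair.
Qed.

Lemma coassociative_dual Delta f g h x :
  coassociative Delta ->
  scalar f -> scalar g -> scalar h ->
  dual_mul Delta (dual_mul Delta f g) h x =
  dual_mul Delta f (dual_mul Delta g h) x.
Proof.
by move=> coA lf lg lh; rewrite -tpair_comulr // -coA tpair_comull.
Qed.

(** The flip in [coleibniz] transposes to an exchange of the first two functionals, so the axiom is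
    the left Leibniz identity for convolution. *)
Lemma coleibniz_dual Delta :
  (forall f g h x, scalar f -> scalar g -> scalar h ->
     dual_mul Delta f (dual_mul Delta g h) x
     - dual_mul Delta g (dual_mul Delta f h) x
     = dual_mul Delta (dual_mul Delta f g) h x) ->
  coleibniz Delta.
Proof.
move=> E x; apply: tensor3_eq => f g h lf lg lh.
rewrite (lin_sub_eq (V := k^o)); last exact: scalar_tpair.
rewrite tpair_tmapl //; last exact: scalar_tpair.
rewrite [X in _ - X](eq_tpair (f' := tpair g f) (g' := h)) //; last first.
  by move=> t /=; rewrite tpair_tswap.
by rewrite !tpair_comulr // tpair_comull // E.
Qed.

End DualProduct.

(** * The Lie bialgebra of an ASI bialgebra *)

Section AsiToLie.
Variables (k : fieldType) (A : vectType k).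
Variables (m : A -> A -> A) (Delta : A -> A ⊗ A).
Hypothesis asi : asi_bialgebra m Delta.

Let ml x : linear (m x).
Proof. by case: asi => -[]. Qed.
Let mr x : linear (m^~ x).
Proof. by case: asi => -[]. Qed.
Let lD : linear Delta.
Proof. by case: asi. Qed.

Lemma commutator_lie_algebra : lie_algebra (commutator_bracket m).
Proof.
rewrite /commutator_bracket; split=> [|x|x y w].
- by split=> x; apply: lin_sub.
- exact: subrr.
- rewrite !(lin_sub_eq (ml _)) !(lin_sub_eq (mr _)) !(asi_assoc asi).
  apply: (separating_eq (separating_scalar A)) => f lf.
  rewrite !(lin_add_eq (V := k^o) lf, lin_opp_eq (V := k^o) lf).
  rewrite (lin_zero (V := k^o) lf); ring.
Qed.

(** The convolution product of the cobracket is the commutator of an associative convolution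
    product, and therefore satisfies the Jacobi identity in its Leibniz form. *)
Lemma commutator_lie_coalgebra : lie_coalgebra (commutator_cobracket Delta).
Proof.
rewrite /commutator_cobracket.
have lC : linear (fun x => Delta x - tswap (Delta x)).
  by apply: lin_sub => //; apply: lin_comp => //; apply: tlift_linear.
split=> [//|x|].
  apply: tensor_eq => f g lf lg; rewrite tpair_tswap //.
  rewrite tpair_opp !tpair_sub.
  by rewrite !tpair_tswap // opprB.
apply: coleibniz_dual => f g h x lf lg lh.
pose T := dual_mul Delta.
have sT a b : scalar (T a b) by apply: scalar_dual_mul.
pose C := dual_mul (fun x => Delta x - tswap (Delta x)).
have CE a b y : scalar a -> scalar b -> C a b y = T a b y - T b a y.
  by move=> la lb; rewrite /C /dual_mul tpair_sub tpair_tswap.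
have sC a b : scalar (C a b) by apply: scalar_dual_mul.
rewrite -!/(C _ _) !CE //.
have Cl a b c : scalar a -> scalar b ->
    T (C a b) c x = T (T a b) c x - T (T b a) c x.
  by move=> la lb; rewrite /T -tpairBl; apply: eq_tpair => // y; apply: CE.
have Cr a b c : scalar a -> scalar b ->
    T c (C a b) x = T c (T a b) x - T c (T b a) x.
  by move=> la lb; rewrite /T -tpairBr; apply: eq_tpair => // y; apply: CE.
rewrite !Cl // !Cr //.
have coA a b c : scalar a -> scalar b -> scalar c ->
    T (T a b) c x = T a (T b c) x.
  by apply: coassociative_dual; case: asi.
rewrite !coA //; ring.
Qed.

(** The ASI cocycle identity accounts for the terms with right multiplication on the first leg or
    left multiplication on the second. The other terms cancel by the symmetry condition, evaluated
    on f ⊗ g and on g ⊗ f. *)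
Lemma asi_lie_bialgebra :
  lie_bialgebra (commutator_bracket m) (commutator_cobracket Delta).
Proof.
split; [exact: commutator_lie_algebra | exact: commutator_lie_coalgebra |].
move=> x y; apply: tensor_eq => f g lf lg.
pose T a b z := tpair a b (Delta z).
have lfl z : scalar (f \o m z) by apply: scalar_comp.
have lgl z : scalar (g \o m z) by apply: scalar_comp.
have lfr z : scalar (f \o m^~ z) by apply: scalar_comp.
have lgr z : scalar (g \o m^~ z) by apply: scalar_comp.
have coc a b u v : scalar a -> scalar b ->
    T a b (m u v) = T (a \o m^~ v) b u + T a (b \o m u) v.
  move=> la lb; rewrite /T (asi_cocycle asi) tpair_add.
  by rewrite tpair_tmapl // tpair_tmapr.
have cmp a b u v : scalar a -> scalar b ->
    T (a \o m u) b v = T a (b \o m^~ u) v + T b (a \o m^~ v) u - T (b \o m v) a u.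
  move=> la lb; have := congr1 (tpair a b) (asi_compat asi u v).
  rewrite tpair_sub tpair_tswap // tpair_sub !tpair_tmapl // !tpair_tmapr //.
  by rewrite /T => E; rewrite -addrA -E addrC subrK.
have adl u (p q : A -> k) t : scalar p -> scalar q ->
    tpair p q (tmap (commutator_bracket m u) id t) =
    tpair (p \o m u) q t - tpair (p \o m^~ u) q t.
  move=> lp lq; rewrite tpair_tmapl // -tpairBl; apply: eq_tpair => // z /=.
  by rewrite (lin_sub_eq (V := k^o)).
have adr u (p q : A -> k) t : scalar p -> scalar q ->
    tpair p q (tmap id (commutator_bracket m u) t) =
    tpair p (q \o m u) t - tpair p (q \o m^~ u) t.
  move=> lp lq; rewrite tpair_tmapr // -tpairBr; apply: eq_tpair => // z /=.
  by rewrite (lin_sub_eq (V := k^o)).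
rewrite !(tpair_add, tpair_opp) !adl // !adr // /commutator_cobracket.
rewrite /commutator_bracket (lin_sub_eq lD) !(tpair_add, tpair_opp).
rewrite !tpair_tswap // !(tpair_add, tpair_opp).
rewrite -!/(T _ _ _) !coc // (cmp f g x y) // (cmp g f x y) //.
ring.
Qed.

End AsiToLie.

(** * Diassociative bialgebras in dual form, and the induced Leibniz bialgebra *)

Section DiassociativeBialgebra.
Variables (k : fieldType) (D : vectType k).
Variables (dl dr : D -> D -> D) (tl tr : D -> D ⊗ D).
Hypothesis hD : diassociative_bialgebra dl dr tl tr.
Implicit Types (f g h : D -> k) (d : D).

Local Notation Tl := (dual_mul tl).
Local Notation Tr := (dual_mul tr).

Let dia := dib_algebra hD.
Let codia := dib_coalgebra hD.

Lemma linear_dl d : linear (dl d).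
Proof. by case: dia => -[]. Qed.
Lemma linear_dlr d : linear (dl^~ d).
Proof. by case: dia => -[]. Qed.
Lemma linear_dr d : linear (dr d).
Proof. by case: dia => _ []. Qed.
Lemma linear_drr d : linear (dr^~ d).
Proof. by case: dia => _ []. Qed.
Lemma linear_tl : linear tl.
Proof. by case: codia. Qed.
Lemma linear_tr : linear tr.
Proof. by case: codia. Qed.

Lemma scalar_dl f d : scalar f -> scalar (f \o dl d).
Proof. by move=> lf; apply: scalar_comp => //; apply: linear_dl. Qed.
Lemma scalar_dlr f d : scalar f -> scalar (f \o dl^~ d).
Proof. by move=> lf; apply: scalar_comp => //; apply: linear_dlr. Qed.
Lemma scalar_dr f d : scalar f -> scalar (f \o dr d).
Proof. by move=> lf; apply: scalar_comp => //; apply: linear_dr. Qed.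
Lemma scalar_drr f d : scalar f -> scalar (f \o dr^~ d).
Proof. by move=> lf; apply: scalar_comp => //; apply: linear_drr. Qed.
Lemma scalar_Tl f g : scalar (Tl f g).
Proof. by apply: scalar_dual_mul; apply: linear_tl. Qed.
Lemma scalar_Tr f g : scalar (Tr f g).
Proof. by apply: scalar_dual_mul; apply: linear_tr. Qed.

#[local] Hint Resolve scalar_dl scalar_dlr scalar_dr scalar_drr : scalar.
#[local] Hint Resolve scalar_Tl scalar_Tr : scalar.
#[local] Hint Extern 0 (GRing.linear_for _ _) =>
  solve [auto with scalar nocore] : core.

(** This lemma and the next eight are the compatibilities (1)-(9) evaluated on product functionals,
    the multiplication operators becoming precompositions. Each is solved for one term, which later
    rewriting eliminates. *)
Lemma dual_dib1 f g d1 d2 : scalar f -> scalar g ->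
  Tl f (g \o dl d1) d2 = Tr (f \o dr^~ d2) g d1.
Proof.
move=> lf lg; have := congr1 (tpair f g) (dib1 hD d1 d2).
by rewrite tpair_tmapr // tpair_tmapl.
Qed.

Lemma dual_dib2 f g d1 d2 : scalar f -> scalar g ->
  Tr (f \o dl d1) g d2 = Tr (g \o dl d2) f d1.
Proof.
move=> lf lg; have := congr1 (tpair f g) (dib2 hD d1 d2).
by rewrite tpair_tmapr // tpair_tmapl // tpair_tswap.
Qed.

Lemma dual_dib3 f g d1 d2 : scalar f -> scalar g ->
  Tl f (g \o dr^~ d1) d2 = Tl g (f \o dr^~ d2) d1.
Proof.
move=> lf lg; have := congr1 (tpair g f) (dib3 hD d1 d2).
by rewrite tpair_tmapr // tpair_tmapl // tpair_tswap.
Qed.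

Lemma dual_dib4 f g d1 d2 : scalar f -> scalar g ->
  Tr f g (dr d1 d2) = Tr f (g \o dr d1) d2
    - (Tr (f \o dr^~ d2) g d1 - Tl (f \o dr^~ d2) g d1
       - (Tr (f \o dl^~ d2) g d1 - Tl (f \o dl^~ d2) g d1)).
Proof.
move=> lf lg; rewrite {1}/dual_mul (dib4 hD) tpair_sub tpair_tmapr //.
by rewrite tpair_tmapBl // !tpair_sub.
Qed.

Lemma dual_dib5 f g d1 d2 : scalar f -> scalar g ->
  Tr f g (dl d1 d2) = Tr f (g \o dl d1) d2 - Tl f (g \o dl d1) d2
    + Tr (f \o dl^~ d2) g d1.
Proof.
move=> lf lg; rewrite {1}/dual_mul (dib5 hD) tpair_add tpair_tmapr //.
by rewrite tpair_tmapl // !tpair_sub.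
Qed.

Lemma dual_dib6 f g d1 d2 : scalar f -> scalar g ->
  Tl f g (dr d1 d2) = Tl f (g \o dr d1) d2 - Tl f (g \o dl d1) d2
    + Tl (f \o dr^~ d2) g d1.
Proof.
move=> lf lg; rewrite {1}/dual_mul (dib6 hD) tpair_add tpair_tmapl //.
by rewrite tpair_tmapBr.
Qed.

Lemma dual_dib7 f g d1 d2 : scalar f -> scalar g ->
  Tl f g (dl d1 d2) = Tl (f \o dl^~ d2) g d1
    - (Tr f (g \o dr d1) d2 - Tl f (g \o dr d1) d2
       - (Tr f (g \o dl d1) d2 - Tl f (g \o dl d1) d2)).
Proof.
move=> lf lg; rewrite {1}/dual_mul (dib7 hD) tpair_sub tpair_tmapl //.
by rewrite tpair_tmapBr // !tpair_sub.
Qed.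

Lemma dual_dib8 f g d1 d2 : scalar f -> scalar g ->
  Tr f (g \o dl^~ d1) d2 =
    Tr (f \o dr d1) g d2 - Tr (f \o dl d1) g d2 + Tl (g \o dl d2) f d1
    - (Tr g (f \o dr^~ d2) d1 - Tl g (f \o dr^~ d2) d1
       - (Tr g (f \o dl^~ d2) d1 - Tl g (f \o dl^~ d2) d1)).
Proof.
move=> lf lg; have := congr1 (tpair f g) (dib8 hD d1 d2).
rewrite !tpair_add tpair_tmapBl // !tpair_tmapr // tpair_tmapBl //.
by rewrite !tpair_tswap // !tpair_sub /dual_mul => ->; rewrite addrC addKr.
Qed.

Lemma dual_dib9 f g d1 d2 : scalar f -> scalar g ->
  Tl g (f \o dl^~ d1) d2 =
    Tr (f \o dr d2) g d1 - Tl (f \o dr d2) g d1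
    - (Tr (f \o dl d2) g d1 - Tl (f \o dl d2) g d1)
    + Tl (g \o dr d1) f d2
    - (Tr f (g \o dr^~ d2) d1 - Tl f (g \o dr^~ d2) d1).
Proof.
move=> lf lg; have := congr1 (tpair f g) (dib9 hD d1 d2).
rewrite !tpair_add tpair_tmapBl // tpair_tmapl // !tpair_tmapr //.
by rewrite !tpair_tswap // !tpair_sub /dual_mul => <-; rewrite addrK.
Qed.

Lemma dual_TlA f g h x : scalar f -> scalar g -> scalar h ->
  Tl (Tl f g) h x = Tl f (Tl g h) x.
Proof.
by apply: coassociative_dual; case: codia.
Qed.

Lemma dual_TrA f g h x : scalar f -> scalar g -> scalar h ->
  Tr (Tr f g) h x = Tr f (Tr g h) x.
Proof.
by apply: coassociative_dual; case: codia.
Qed.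

Lemma dual_inner_l f g h x : scalar f -> scalar g -> scalar h ->
  Tl f (Tr g h) x = Tl f (Tl g h) x.
Proof.
move=> lf lg lh; rewrite -dual_TlA //.
by rewrite -tpair_comull // (codia_inner_l codia) tpair_comulr.
Qed.

Lemma dual_mixed f g h x : scalar f -> scalar g -> scalar h ->
  Tl (Tr f g) h x = Tr f (Tl g h) x.
Proof.
move=> lf lg lh.
by rewrite -tpair_comull // (codia_mixed codia) tpair_comulr.
Qed.

Lemma dual_inner_r f g h x : scalar f -> scalar g -> scalar h ->
  Tr (Tl f g) h x = Tr f (Tr g h) x.
Proof.
move=> lf lg lh; rewrite -dual_TrA //.
by rewrite -tpair_comull // (codia_inner_r codia) tpair_comull.
Qed.

(** The dual of D is a diassociative algebra. As rewriting rules its axioms leave three triple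
    products, f ⊣ (g ⊣ h), f ⊢ (g ⊣ h) and f ⊢ (g ⊢ h); [diaE] does the same in D. *)
Definition dual_diaE :=
  (dual_TlA, dual_TrA, dual_inner_l, dual_mixed, dual_inner_r).

Lemma dl_drE d1 d2 d3 : dl d1 (dr d2 d3) = dl d1 (dl d2 d3).
Proof. by rewrite -(dia_inner_l dia) (dia_dlA dia). Qed.

Lemma dr_dlE d1 d2 d3 : dr (dl d1 d2) d3 = dr d1 (dr d2 d3).
Proof. by rewrite (dia_inner_r dia) (dia_drA dia). Qed.

Definition diaE := (dl_drE, dr_dlE, dia_dlA dia, dia_drA dia, dia_mixed dia).

Lemma linear_leib_comul : linear (leib_comul tl tr).
Proof.
apply: lin_sub; first exact: linear_tr.
by apply: lin_comp; [apply: tlift_linear | apply: linear_tl].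
Qed.

Lemma dual_leibE f g x : scalar f -> scalar g ->
  dual_mul (leib_comul tl tr) f g x = Tr f g x - Tl g f x.
Proof. by move=> lf lg; rewrite /dual_mul tpair_sub tpair_tswap. Qed.

Lemma leibniz_algebra_leib_mul : leibniz_algebra (leib_mul dl dr).
Proof.
rewrite /leib_mul; split=> [|x y w].
  split=> x; apply: lin_sub.
  - exact: linear_drr.
  - exact: linear_dl.
  - exact: linear_dr.
  - exact: linear_dlr.
rewrite !(lin_sub_eq (linear_dl _), lin_sub_eq (linear_dr _),
          lin_sub_eq (linear_dlr _), lin_sub_eq (linear_drr _)) !diaE.
apply: (separating_eq (separating_scalar D)) => f lf.
rewrite !(lin_add_eq (V := k^o) lf, lin_opp_eq (V := k^o) lf); ring.
Qed.

Lemma leibniz_coalgebra_leib_comul : leibniz_coalgebra (leib_comul tl tr).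
Proof.
split; first exact: linear_leib_comul.
apply: coleibniz_dual => f g h x lf lg lh.
set M := dual_mul (leib_comul tl tr).
have sM a b : scalar (M a b) by apply: scalar_dual_mul; apply: linear_leib_comul.
have Ml N a b c : scalar a -> scalar b ->
    dual_mul N (M a b) c x = dual_mul N (Tr a b) c x - dual_mul N (Tl b a) c x.
  by move=> la lb; rewrite -tpairBl; apply: eq_tpair => // y; apply: dual_leibE.
have Mr N a b c : scalar a -> scalar b ->
    dual_mul N c (M a b) x = dual_mul N c (Tr a b) x - dual_mul N c (Tl b a) x.
  by move=> la lb; rewrite -tpairBr; apply: eq_tpair => // y; apply: dual_leibE.
have ME a b y : scalar a -> scalar b -> M a b y = Tr a b y - Tl b a y.
  exact: dual_leibE.
rewrite !ME // !Ml // !Mr // !dual_diaE //; ring.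
Qed.

(** The symmetry condition follows from (1)-(3). In the cocycle identity, (4)-(7) expand the four
    terms of ϑ(d1 ∗ d2), (8) and (9) remove right ⊣-multiplication by d1, and (1) and (2) match what
    is left. *)
Lemma leibniz_bialgebra_leib :
  leibniz_bialgebra (leib_mul dl dr) (leib_comul tl tr).
Proof.
split=> [||d1 d2|d1 d2]; [exact: leibniz_algebra_leib_mul
  | exact: leibniz_coalgebra_leib_comul | | ].
  apply: tensor_eq => f g lf lg; rewrite tpair_tswap // !tpair_tmapBl //.
  rewrite !tpair_sub !tpair_tswap // -!/(dual_mul _ _ _ _).
  rewrite (dual_dib2 d1 d2 lf lg) (dual_dib3 d2 d1 lf lg).
  rewrite (dual_dib1 d1 d2 lg lf) (dual_dib1 d2 d1 lf lg); ring.
apply: tensor_eq => f g lf lg.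
rewrite {1}/leib_mul (lin_sub_eq linear_leib_comul) !(tpair_add, tpair_opp).
rewrite tpair_tmapDl // !(tpair_tmapBl, tpair_tmapBr) //.
rewrite !(tpair_add, tpair_opp) !tpair_tswap // !(tpair_add, tpair_opp).
rewrite !tpair_tswap // -!/(dual_mul _ _ _ _).
rewrite (dual_dib4 d1 d2 lf lg) (dual_dib6 d1 d2 lg lf).
rewrite (dual_dib5 d2 d1 lf lg) (dual_dib7 d2 d1 lg lf).
rewrite (dual_dib8 d1 d2 lf lg) (dual_dib9 d1 d2 lf lg).
rewrite (dual_dib2 d1 d2 lf lg) (dual_dib1 d1 d2 lg lf).
ring.
Qed.

End DiassociativeBialgebra.

(** * The ASI bialgebra on D ⊗ B and its comparison with the Leibniz construction *)

Section AffinizationByQuadraticZinbiel.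
Variables (k : fieldType) (D B : vectType k) (dl dr : D -> D -> D).
Variables (tl tr : D -> D ⊗ D) (z : B -> B -> B) (w : B -> B -> k).
Variable nu : B -> B ⊗ B.
Hypothesis hD : diassociative_bialgebra dl dr tl tr.
Hypothesis hB : quadratic_zinbiel z w.
Hypothesis hnu : is_nu z w nu.
Implicit Types (f g h : D -> k) (b c e : B) (d : D).

Local Notation Tl := (dual_mul tl).
Local Notation Tr := (dual_mul tr).
Local Notation m := (asi_mul dl dr z).
Local Notation Delta := (asi_comul tl tr nu).

Lemma linear_zl b : linear (z b).
Proof. by case: hB => -[[]]. Qed.
Lemma linear_zr b : linear (z^~ b).
Proof. by case: hB => -[[]]. Qed.
Lemma scalar_wr b : scalar (w b).
Proof. by case: hB. Qed.
Lemma scalar_wl b : scalar (w^~ b).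
Proof. by case: hB. Qed.

#[local] Hint Resolve scalar_wr scalar_wl linear_zl linear_zr : scalar.
#[local] Hint Extern 1 (GRing.linear_for _ _) => first
  [ exact: (linear_dl hD) | exact: (linear_dlr hD) | exact: (linear_dr hD)
  | exact: (linear_drr hD) | exact: (linear_tl hD) | exact: (linear_tr hD)
  | exact: (scalar_Tl hD) | exact: (scalar_Tr hD)
  | apply: (scalar_dl hD) | apply: (scalar_dlr hD)
  | apply: (scalar_dr hD) | apply: (scalar_drr hD) ] : scalar.
#[local] Hint Extern 0 (GRing.linear_for _ _) =>
  solve [auto with scalar nocore] : core.

(** * Adjoints of Zinbiel multiplications with respect to ϖ *)

Definition wDr b := lin_add_eq (V := k^o) (scalar_wr b).
Definition zDl b := lin_add_eq (linear_zl b).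
Definition zDr b := lin_add_eq (linear_zr b).

Lemma form_mull b c e : w (z b c) e = w c (z b e) + w c (z e b).
Proof. by rewrite (qz_invariant hB) wDr. Qed.

(** By invariance and skew-symmetry, ϖ(e, b ⋄ c) = ϖ(c ⋄ e, b) + ϖ(c ⋄ b, e), which is symmetric in
    b and e. *)
Lemma form_mulr b c e : w (z b c) e = - w b (z e c).
Proof.
have E1 := form_mull c e b; have E2 := form_mull c b e.
rewrite (qz_skew hB e (z c b)) in E1; rewrite (qz_skew hB b (z c e)) in E2.
rewrite (qz_skew hB _ e); congr (- _).
have -> : w e (z b c) = w (z c e) b + w (z c b) e by rewrite E1; ring.
by rewrite E2; ring.
Qed.

(** This lemma and the next three exchange [b'], standing alone in the form, with [b] inside a
    double product, so that all scalars acquire the same left argument and can be compared. *)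
Lemma form_zzl_outer b b' c e :
  w b' (z (z c b) e) = w b (z c (z b' e)) + w b (z (z b' e) c).
Proof. by rewrite (qz_skew hB) form_mulr opprK form_mull. Qed.

Lemma form_zzr_outer b b' c e :
  w b' (z (z b c) e) = - w b (z (z b' e) c).
Proof. by rewrite (qz_skew hB) form_mulr opprK form_mulr. Qed.

Lemma form_zzr_inner b b' c e :
  w b' (z c (z b e)) = w b (z (z c b') e) + w b (z (z b' c) e).
Proof. by rewrite (qz_skew hB) form_mull !(form_mulr b); ring. Qed.

Lemma form_zzl_inner b b' c e :
  w b' (z c (z e b)) = - (w b (z e (z c b')) + w b (z e (z b' c))
     + w b (z (z c b') e) + w b (z (z b' c) e)).
Proof. by rewrite (qz_skew hB) form_mull !(form_mull e); ring. Qed.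

(** * The functionals f ⊗ ϖ(-, c) on D ⊗ B *)

Definition functional_DB f c : D ⊗ B -> k := tpair f (w^~ c).
Local Notation phi := functional_DB.

Lemma scalar_functional_DB f c : scalar (phi f c).
Proof. exact: scalar_tpair. Qed.
#[local] Hint Resolve scalar_functional_DB : scalar.

Lemma functional_DB_tens f c d b : scalar f -> phi f c (d ⊗ b) = f d * w b c.
Proof. by move=> lf; rewrite /phi tpair_tens. Qed.

Lemma functional_DB_add f c x y : phi f c (x + y) = phi f c x + phi f c y.
Proof. exact: tpair_add. Qed.

Lemma separating_form :
  separating (fun q : B -> k => exists c, q = w^~ c).
Proof.
split=> [_ [c ->]|b E]; first exact: scalar_wl.
by apply: (qz_nondegenerate hB) => c; apply: (E (w^~ c)); exists c.
Qed.

Lemma functional_DB_eq (x y : D ⊗ B) :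
  (forall f c, scalar f -> phi f c x = phi f c y) -> x = y.
Proof.
have sA := separating_tens (separating_scalar D) separating_form.
move=> E; apply: (separating_eq sA).
by move=> _ [f _ lf [c ->]]; apply: E.
Qed.

Lemma functional_DB2_eq (x y : (D ⊗ B) ⊗ (D ⊗ B)) :
  (forall f g c e, scalar f -> scalar g ->
     tpair (phi f c) (phi g e) x = tpair (phi f c) (phi g e) y) -> x = y.
Proof.
have sA := separating_tens (separating_scalar D) separating_form.
move=> E; apply: (separating_eq (separating_tens sA sA)).
by move=> _ [_ _ [f _ lf [c ->]] [g _ lg [e ->]]]; apply: E.
Qed.

Lemma functional_DB3_eq (x y : ((D ⊗ B) ⊗ (D ⊗ B)) ⊗ (D ⊗ B)) :
  (forall f g h c e a, scalar f -> scalar g -> scalar h ->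
     tpair (tpair (phi f c) (phi g e)) (phi h a) x =
     tpair (tpair (phi f c) (phi g e)) (phi h a) y) -> x = y.
Proof.
have sA := separating_tens (separating_scalar D) separating_form.
move=> E; apply: (separating_eq (separating_tens (separating_tens sA sA) sA)).
by move=> _ [_ _ [_ _ [f _ lf [c ->]] [g _ lg [e ->]]] [h _ lh [a ->]]]; apply: E.
Qed.

(** The convolution of ϖ(-, c) and ϖ(-, e) is ϖ(-, c ⋄ e): under ϖ, the product dual to ν is ⋄
    itself. *)
Lemma tpair_nu b c e : tpair (w^~ c) (w^~ e) (nu b) = w b (z c e).
Proof.
rewrite -hnu; apply: (eq_tlift (W := k^o)) => u v; rewrite tlift_tens //.
split=> [y a x x'|x a y y'] /=.
  by rewrite scalar_wr mulrDl -mulrA.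
by rewrite scalar_wr mulrDr mulrCA.
Qed.

(** [is_nu] prescribes only values under ϖ; these are linear in b, and nondegeneracy makes them
    determine ν. *)
Lemma linear_nu : linear nu.
Proof.
move=> a b b'; have sB := separating_form.
apply: (separating_eq (separating_tens sB sB)).
move=> _ [_ _ [c ->] [e ->]]; rewrite (scalar_tpair (w^~ c)) !tpair_nu.
exact: scalar_wl.
Qed.

Lemma bullet_bilinear : is_bilinear (@bullet k D B).
Proof. exact: tlift2_bilinear. Qed.

(** * Product and coproduct on D ⊗ B *)

Lemma asi_mul_bilinear : is_bilinear m.
Proof. exact: tlift2_bilinear. Qed.

Lemma asi_mul_tens d1 b1 d2 b2 :
  m (d1 ⊗ b1) (d2 ⊗ b2) = dr d1 d2 ⊗ z b1 b2 + dl d1 d2 ⊗ z b2 b1.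
Proof.
rewrite /asi_mul tlift2_tens // => d b; split=> x; apply: lin_add;
  by (apply: lin_tens_compl || apply: lin_tens_compr).
Qed.

Lemma asi_comul_tens d b :
  Delta (d ⊗ b) = bullet (tr d) (nu b) + bullet (tl d) (tswap (nu b)).
Proof.
have ln := linear_nu; case: bullet_bilinear => bl br.
rewrite /asi_comul tlift_tens //; split=> x; apply: lin_add.
- exact: (lin_comp (bl (nu x))).
- exact: (lin_comp (bl (tswap (nu x)))).
- exact: (lin_comp (br (tr x))).
- by apply: (lin_comp (br (tl x))); apply: lin_comp => //; apply: tlift_linear.
Qed.

Lemma linear_asi_comul : linear Delta.
Proof. exact: tlift_linear. Qed.

#[local] Hint Resolve linear_asi_comul : scalar.

(* The convolution product of functionals has the same shape as asi_mul. *)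
Lemma dual_asi_comul f g c e x : scalar f -> scalar g ->
  dual_mul Delta (phi f c) (phi g e) x =
  phi (Tr f g) (z c e) x + phi (Tl f g) (z e c) x.
Proof.
move=> lf lg; move: x; apply: (tens_eq_linear (W := k^o)).
- by apply: scalar_dual_mul.
- by apply: (lin_add (V := k^o)); apply: scalar_functional_DB.
move=> d b; rewrite /dual_mul asi_comul_tens tpair_add !tpair_bullet //.
by rewrite tpair_tswap // !tpair_nu !functional_DB_tens.
Qed.

(** The transpose of multiplication by d ⊗ b: on the B-side, left and right multiplication by b pass
    to their adjoints L_b + R_b and - R_b. *)
Lemma functional_DB_mull f c d b x : scalar f ->
  phi f c (m (d ⊗ b) x) =
  phi (f \o dr d) (z b c + z c b) x - phi (f \o dl d) (z c b) x.
Proof.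
move=> lf; move: x; apply: (tens_eq_linear (W := k^o)).
- apply: (lin_comp (W := k^o)); first exact: scalar_functional_DB.
  by case: asi_mul_bilinear.
- by apply: (lin_sub (V := k^o)); apply: scalar_functional_DB.
move=> d' b'; rewrite asi_mul_tens functional_DB_add.
rewrite !functional_DB_tens // (form_mull b) (form_mulr b') wDr /=; ring.
Qed.

Lemma functional_DB_mulr f c d b x : scalar f ->
  phi f c (m x (d ⊗ b)) =
  phi (f \o dl^~ d) (z b c + z c b) x - phi (f \o dr^~ d) (z c b) x.
Proof.
move=> lf; move: x; apply: (tens_eq_linear (W := k^o)).
- apply: (lin_comp (W := k^o)); first exact: scalar_functional_DB.
  by case: asi_mul_bilinear.
- by apply: (lin_sub (V := k^o)); apply: scalar_functional_DB.
move=> d' b'; rewrite asi_mul_tens functional_DB_add.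
rewrite !functional_DB_tens // (form_mull b) (form_mulr b') wDr /=; ring.
Qed.

(** The diassociative axioms leave three triple products in D, and the Zinbiel axiom turns each x ⋄
    (y ⋄ z) into (x ⋄ y) ⋄ z + (y ⋄ x) ⋄ z. The two sides then have equal coefficients. *)
Lemma asi_mulA x y t : m (m x y) t = m x (m y t).
Proof.
case: asi_mul_bilinear => ml mr.
move: x y; apply: tens_eq_bilinear.
- split=> u; first exact: (lin_comp (ml t) (ml u)).
  exact: (lin_comp (ml t) (mr u)).
- split=> u; first exact: ml.
  exact: (lin_comp (mr u) (ml t)).
move=> d1 b1 d2 b2; move: t; apply: tens_eq_linear => [||d3 b3].
- exact: mr.
- exact: (lin_comp (mr _) (mr _)).
rewrite !(asi_mul_tens, lin_add_eq (mr _), lin_add_eq (ml _)).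
rewrite !(diaE hD) !(zin_axiom (qz_zinbiel hB)).
rewrite !(lin_add_eq (lin_tensr _)).
apply: functional_DB_eq => f c lf.
rewrite !functional_DB_add !functional_DB_tens //.
ring.
Qed.

Lemma asi_comulA : coassociative Delta.
Proof.
apply: tens_eq_linear.
- by apply: lin_comp => //; apply: tlift_linear.
- apply: lin_comp; first exact: tlift_linear.
  by apply: lin_comp => //; apply: tlift_linear.
move=> d b; apply: functional_DB3_eq => f g h c e a lf lg lh.
rewrite tpair_comull // tpair_comulr //.
have El p q u v (psi : D ⊗ B -> k) x : scalar p -> scalar q ->
    dual_mul Delta (dual_mul Delta (phi p u) (phi q v)) psi x =
    dual_mul Delta (phi (Tr p q) (z u v)) psi x
    + dual_mul Delta (phi (Tl p q) (z v u)) psi x.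
  move=> lp lq; rewrite -tpairDl; apply: eq_tpair => // y.
  exact: dual_asi_comul.
have Er p q u v (psi : D ⊗ B -> k) x : scalar p -> scalar q ->
    dual_mul Delta psi (dual_mul Delta (phi p u) (phi q v)) x =
    dual_mul Delta psi (phi (Tr p q) (z u v)) x
    + dual_mul Delta psi (phi (Tl p q) (z v u)) x.
  move=> lp lq; rewrite -tpairDr; apply: eq_tpair => // y.
  exact: dual_asi_comul.
rewrite El // Er // !dual_asi_comul // !functional_DB_tens //.
rewrite !(dual_diaE hD) // !(zin_axiom (qz_zinbiel hB)) !wDr; ring.
Qed.

Lemma tpair_mull_l f c d b (psi : D ⊗ B -> k) t : scalar f ->
  tpair (phi f c \o m (d ⊗ b)) psi t =
  tpair (phi (f \o dr d) (z b c + z c b)) psi t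
  - tpair (phi (f \o dl d) (z c b)) psi t.
Proof.
move=> lf; rewrite -tpairBl; apply: eq_tpair => // x.
exact: functional_DB_mull.
Qed.

Lemma tpair_mulr_l f c d b (psi : D ⊗ B -> k) t : scalar f ->
  tpair (phi f c \o m^~ (d ⊗ b)) psi t =
  tpair (phi (f \o dl^~ d) (z b c + z c b)) psi t
  - tpair (phi (f \o dr^~ d) (z c b)) psi t.
Proof.
move=> lf; rewrite -tpairBl; apply: eq_tpair => // x.
exact: functional_DB_mulr.
Qed.

Lemma tpair_mull_r f c d b (psi : D ⊗ B -> k) t : scalar f ->
  tpair psi (phi f c \o m (d ⊗ b)) t =
  tpair psi (phi (f \o dr d) (z b c + z c b)) t
  - tpair psi (phi (f \o dl d) (z c b)) t.
Proof.
move=> lf; rewrite -tpairBr; apply: eq_tpair => // x.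
exact: functional_DB_mull.
Qed.

Lemma tpair_mulr_r f c d b (psi : D ⊗ B -> k) t : scalar f ->
  tpair psi (phi f c \o m^~ (d ⊗ b)) t =
  tpair psi (phi (f \o dl^~ d) (z b c + z c b)) t
  - tpair psi (phi (f \o dr^~ d) (z c b)) t.
Proof.
move=> lf; rewrite -tpairBr; apply: eq_tpair => // x.
exact: functional_DB_mulr.
Qed.

Lemma linear_ml x : linear (m x).
Proof. by case: asi_mul_bilinear. Qed.
Lemma linear_mr x : linear (m^~ x).
Proof. by case: asi_mul_bilinear. Qed.

Lemma tmapl_bilinear (F : D ⊗ B -> D ⊗ B -> D ⊗ B) : is_bilinear F ->
  is_bilinear (fun x y => tmap (F x) id (Delta y)).
Proof.
move=> [Fl _]; split=> [y|x].
  by apply: lin_tlift => u v; apply: lin_tens_compl.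
by apply: lin_comp => //; apply: tlift_linear.
Qed.

Lemma tmapr_bilinear (F : D ⊗ B -> D ⊗ B -> D ⊗ B) : is_bilinear F ->
  is_bilinear (fun x y => tmap id (F x) (Delta y)).
Proof.
move=> [Fl _]; split=> [y|x].
  by apply: lin_tlift => u v; apply: lin_tens_compr.
by apply: lin_comp => //; apply: tlift_linear.
Qed.

Lemma asi_mul_cocycle x y :
  Delta (m x y) = tmap (m^~ y) id (Delta x) + tmap id (m x) (Delta y).
Proof.
have mop : is_bilinear (fun x y => m y x).
  by split=> u; [apply: linear_ml | apply: linear_mr].
have [tll tlr] := tmapl_bilinear mop.
have [trl trr] := tmapr_bilinear asi_mul_bilinear.
move: x y; apply: tens_eq_bilinear.
- split=> u; apply: (lin_comp (f := Delta)) => //.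
    exact: linear_mr.
  exact: linear_ml.
- by split=> u; apply: lin_add.
move=> d1 b1 d2 b2; apply: functional_DB2_eq => f g c e lf lg.
rewrite asi_mul_tens (lin_add_eq linear_asi_comul) !tpair_add.
rewrite tpair_tmapl // tpair_tmapr // tpair_mulr_l // tpair_mull_r //.
rewrite -!/(dual_mul _ _ _ _) !dual_asi_comul // !functional_DB_tens //.
(* Every scalar from B is brought to the form ϖ(b1, -); the Zinbiel axiom below then leaves only the
   values ϖ(b1, (x ⋄ y) ⋄ z) with x, y, z an ordering of b2, c, e. *)
rewrite !(form_mulr b1) !(form_mull b2) !(zDl, zDr) !wDr.
rewrite !(form_zzl_outer b1 b2, form_zzr_outer b1 b2,
          form_zzl_inner b1 b2, form_zzr_inner b1 b2).
rewrite (dual_dib4 hD d1 d2 lf lg) (dual_dib5 hD d1 d2 lf lg).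
rewrite (dual_dib6 hD d1 d2 lf lg) (dual_dib7 hD d1 d2 lf lg).
rewrite (dual_dib1 hD d1 d2 lf lg) !(zin_axiom (qz_zinbiel hB)) !wDr.
ring.
Qed.

Lemma asi_mul_compat x y :
  tmap (m x) id (Delta y) - tmap id (m^~ x) (Delta y) =
  tswap (tmap id (m^~ y) (Delta x) - tmap (m y) id (Delta x)).
Proof.
have mop : is_bilinear (fun x y => m y x).
  by split=> u; [apply: linear_ml | apply: linear_mr].
have [tll tlr] := tmapl_bilinear asi_mul_bilinear.
have [trl trr] := tmapr_bilinear mop.
move: x y; apply: tens_eq_bilinear.
- by split=> u; apply: lin_sub.
- split=> u; apply: (lin_comp (f := @tswap k (D ⊗ B)%type (D ⊗ B)%type)).
  + exact: tlift_linear.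
  + by apply: lin_sub.
  + exact: tlift_linear.
  + by apply: lin_sub.
move=> d1 b1 d2 b2; apply: functional_DB2_eq => f g c e lf lg.
rewrite tpair_tswap // !tpair_sub !tpair_tmapl // !tpair_tmapr //.
rewrite !tpair_mull_l // !tpair_mulr_r //.
rewrite -!/(dual_mul _ _ _ _) !dual_asi_comul // !functional_DB_tens //.
rewrite !(zDl, zDr) !wDr.
rewrite !(form_zzl_outer b1 b2, form_zzr_outer b1 b2,
          form_zzl_inner b1 b2, form_zzr_inner b1 b2).
(* The condition is symmetric under exchanging the two arguments together with the two legs, so (9)
   enters for both orders of d1 and d2. *)
rewrite (dual_dib8 hD d1 d2 lf lg) (dual_dib9 hD d1 d2 lg lf).
rewrite (dual_dib9 hD d2 d1 lf lg) (dual_dib3 hD d1 d2 lf lg).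
rewrite (dual_dib2 hD d1 d2 lf lg) !(zin_axiom (qz_zinbiel hB)) !wDr.
ring.
Qed.

Lemma asi_bialgebra_DB : asi_bialgebra m Delta.
Proof.
split; [exact: asi_mul_bilinear | exact: asi_mulA | exact: linear_asi_comul
  | exact: asi_comulA | exact: asi_mul_cocycle | exact: asi_mul_compat].
Qed.

(** * Agreement of the two constructions *)

Lemma commutator_bracket_leib x y :
  commutator_bracket m x y = leib_lie_bracket (leib_mul dl dr) z x y.
Proof.
have [[Ml Mr] _] := leibniz_algebra_leib_mul hD.
move: x y; apply: tens_eq_bilinear.
- by split=> u; apply: lin_sub; (apply: linear_ml || apply: linear_mr).
- exact: tlift2_bilinear.
- move=> d1 b1 d2 b2; rewrite /commutator_bracket !asi_mul_tens.
  rewrite /leib_lie_bracket tlift2_tens; last 2 first.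
  + by move=> d b; split=> u; apply: lin_sub;
      (apply: lin_tens_compl || apply: lin_tens_compr).
  + by move=> d b; split=> u; apply: lin_sub;
      (apply: lin_tens_compl || apply: lin_tens_compr).
  rewrite /leib_mul !(lin_sub_eq (lin_tensl _)).
  apply: (separating_eq (separating_scalar (D ⊗ B)%type)) => f lf.
  by rewrite !(lin_add_eq (V := k^o) lf, lin_opp_eq (V := k^o) lf); ring.
Qed.

Lemma commutator_cobracket_leib x :
  commutator_cobracket Delta x = leib_lie_cobracket (leib_comul tl tr) nu x.
Proof.
have [bl br] := bullet_bilinear.
have lt := linear_leib_comul hD; have ln := linear_nu.
have ls := @tlift_linear.
move: x; apply: tens_eq_linear => [||d b].
- by apply: lin_sub => //; apply: lin_comp => //; apply: ls.
- exact: tlift_linear.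
rewrite /commutator_cobracket asi_comul_tens.
rewrite /leib_lie_cobracket tlift_tens; last first.
  split=> u; apply: lin_sub.
  - exact: (lin_comp (bl _)).
  - by apply: lin_comp; [apply: ls | apply: (lin_comp (bl _))].
  - exact: (lin_comp (br _)).
  - by apply: lin_comp; [apply: ls | apply: (lin_comp (br _))].
apply: functional_DB2_eq => f g c e lf lg.
rewrite !tpair_sub !tpair_tswap // !tpair_add !tpair_bullet // !tpair_sub.
by rewrite !tpair_tswap //; ring.
Qed.

End AffinizationByQuadraticZinbiel.

Theorem theorem5p21 (k : fieldType) (k_char0 : [pchar k] =i pred0)
    (D B : vectType k)
    (dl dr : D -> D -> D) (tl tr : D -> D ⊗ D)
    (z : B -> B -> B) (w : B -> B -> k) (nu : B -> B ⊗ B)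
    (hD : diassociative_bialgebra dl dr tl tr)
    (hB : quadratic_zinbiel z w)
    (hnu : is_nu z w nu) :
  let mulI := asi_mul dl dr z in
  let comulI := asi_comul tl tr nu in
  let bracketI := commutator_bracket mulI in
  let cobracketI := commutator_cobracket comulI in
  let mulII := leib_mul dl dr in
  let comulII := leib_comul tl tr in
  let bracketII := leib_lie_bracket mulII z in
  let cobracketII := leib_lie_cobracket comulII nu in
  [/\ asi_bialgebra mulI comulI /\ lie_bialgebra bracketI cobracketI,
      leibniz_bialgebra mulII comulII /\ lie_bialgebra bracketII cobracketII,
      bracketI =2 bracketII
    & cobracketI =1 cobracketII].
Proof.
have asi := asi_bialgebra_DB hD hB hnu.
have liebi := asi_lie_bialgebra asi.
have brE := commutator_bracket_leib hD hB.
have cobrE := commutator_cobracket_leib hD hB hnu.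
move=> mulI comulI bracketI cobracketI mulII comulII bracketII cobracketII.
split=> //; split; first exact: leibniz_bialgebra_leib.
(* The Lie bialgebra of construction (II) is that of (I), transported along the equality of the
   structure maps. *)
have <- : bracketI = bracketII.
  by apply: functional_extensionality => x; apply: functional_extensionality => y.
by have <- : cobracketI = cobracketII by apply: functional_extensionality.
Qed.
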